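(* For every $\psi\in AHHol_3^{LF}(\mathbb{C}P^3)$ there exist $g\in PSp(2)$ and $\omega\in PSU(2)$ such that $g\circ\psi\circ\omega=\Psi^3$, where $$\Psi^3(z)=[1,\,-z^3,\,\sqrt3\,z,\,\sqrt3\,z^2].$$
   Context: Identify $S^2=\mathbb{C}P^1=\mathbb{C}\cup\{\infty\}$ with coordinate $z$, so that the antipodal map is $z\mapsto-1/\bar z$. The twistor fibration $\pi:\mathbb{C}P^3\to S^4\subset\mathbb{C}^2\oplus\mathbb{R}=\mathbb{R}^5$ is $$\pi([z_1,z_2,z_3,z_4])=\frac{\left(2(\bar z_1z_3+z_2\bar z_4),\,2(\bar z_1z_4-z_2\bar z_3),\,|z_1|^2+|z_2|^2-|z_3|^2-|z_4|^2\right)}{|z_1|^2+|z_2|^2+|z_3|^2+|z_4|^2}.$$ A holomorphic curve $\psi=[f_1,f_2,f_3,f_4]:S^2\to\mathbb{C}P^3$ is horizontal if it is tangent to the orthogonal complement (for the Fubini-Study metric) of the fibers of $\pi$; equivalently $f_1'f_2-f_1f_2'+f_3'f_4-f_3f_4'=0$. It is linearly full if its image lies in no projective hyperplane. A holomorphic curve of degree $d$ is written $[f_1,f_2,f_3,f_4]$ with $f_i$ polynomials without common zeros and maximal degree $d$. $HHol_d^{LF}(\mathbb{C}P^3)$ is the set of linearly full horizontal holomorphic curves $S^2\to\mathbb{C}P^3$ of degree $d$. $AHHol_d^{LF}(\mathbb{C}P^3)\subset HHol_d^{LF}(\mathbb{C}P^3)$ is the subset of those $\psi$ for which $\pi\circ\psi:S^2\to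 S^4$ is invariant under the antipodal map of $S^2$ (these are the twistor lifts of the linearly full harmonic maps $S^2\to S^4$ of degree $d$ that factor through $\mathbb{R}P^2$). Let $J$ be the $4\times4$ matrix that is block diagonal with two blocks $\begin{pmatrix}0&-1\\1&0\end{pmatrix}$, $Sp(2;\mathbb{C})=\{A\in SL(4;\mathbb{C}): A^tJA=J\}$, $Sp(2)=Sp(2;\mathbb{C})\cap U(4)$. $PSp(2)$ is its projectivization, acting on $\mathbb{C}P^3$ in the standard way and on curves by postcomposition. $PSU(2)\cong SO(3)$ acts on $S^2=\mathbb{C}P^1$ by rotations (Möbius transformations) and on curves by precomposition. *)

(* Defs.v *)
From mathcomp Require Import all_boot all_order all_algebra.
From mathcomp Require Import complex ring.
From mathcomp Require Import boolp classical_sets reals topology normedtype derive.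

Set Implicit Arguments.
Unset Strict Implicit.
Unset Printing Implicit Defensive.

Import Order.TTheory GRing.Theory Num.Theory.
Import numFieldNormedType.Exports.

Local Open Scope ring_scope.
Local Open Scope sesquilinear_scope.

(** A point of CP^3 is represented by the corresponding line in C^4; lines are
    taken among all subspaces of C^4, and [proj_pt v] is one when [v != 0]. *)
Definition CP3 (R : realType) := {vspace 'cV[R[i]]_4}.

Definition proj_pt (R : realType) (v : 'cV[R[i]]_4) : CP3 R := <[v]>%VS.

(** S^2 = C u {oo}, with [None] for the point at infinity. *)
Definition S2 (R : realType) := option R[i].

Definition antipodal (R : realType) (p : S2 R) : S2 R :=
  match p with
  | Some z => if z == 0 then None else Some (- (z^*)^-1)
  | None => Some 0
  end.

Definition mobius (R : realType) (M : 'M[R[i]]_2) (p : S2 R) : S2 R :=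
  match p with
  | Some z => let den := M 1 0 * z + M 1 1 in
      if den == 0 then None else Some ((M 0 0 * z + M 0 1) / den)
  | None => if M 1 0 == 0 then None else Some (M 0 0 / M 1 0)
  end.

(** PSU(2) as the group of transformations of S^2 induced by SU(2). *)
Definition PSU2 (R : realType) (omega : S2 R -> S2 R) : Prop :=
  exists M : 'M[R[i]]_2,
    [/\ M \is unitarymx, \det M = 1 & omega =1 mobius M].

Definition J2 (R : realType) : 'M[R[i]]_2 := delta_mx 1 0 - delta_mx 0 1.

Definition J4 (R : realType) : 'M[R[i]]_4 :=
  @block_mx R[i] 2 2 2 2 (J2 R) 0 0 (J2 R).

Definition Sp2C (R : realType) (A : 'M[R[i]]_4) : Prop :=
  \det A = 1 /\ A^T *m J4 R *m A = J4 R.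

Definition Sp2 (R : realType) (A : 'M[R[i]]_4) : Prop :=
  Sp2C A /\ A \is unitarymx.

Definition proj_act (R : realType) (A : 'M[R[i]]_4) (U : CP3 R) : CP3 R :=
  (linfun (mulmx A : 'cV[R[i]]_4 -> 'cV[R[i]]_4) @: U)%VS.

(** PSp(2) as the group of transformations of CP^3 induced by Sp(2). *)
Definition PSp2 (R : realType) (g : CP3 R -> CP3 R) : Prop :=
  exists A : 'M[R[i]]_4, Sp2 A /\ g =1 proj_act A.

Definition twistor_vec (R : realType) (v : 'cV[R[i]]_4) : R[i] * R[i] * R :=
  let z1 := v 0 0 in let z2 := v 1 0 in let z3 := v 2 0 in let z4 := v 3 0 in
  let n := `|z1| ^+ 2 + `|z2| ^+ 2 + `|z3| ^+ 2 + `|z4| ^+ 2 in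
  (2 * (z1^* * z3 + z2 * z4^*) / n,
   2 * (z1^* * z4 - z2 * z3^*) / n,
   complex.Re ((`|z1| ^+ 2 + `|z2| ^+ 2 - `|z3| ^+ 2 - `|z4| ^+ 2) / n)).

(** [vpick U] is a nonzero vector of [U]; by [twistorE] below the choice does
    not matter. *)
Definition twistor (R : realType) (U : CP3 R) : R[i] * R[i] * R :=
  twistor_vec (vpick U).

(** C^2 (+) R = R^5 *)
Definition toR5 (R : realType) (x : R[i] * R[i] * R) : 'rV[R]_5 :=
  \row_(k < 5) [:: complex.Re x.1.1; complex.Im x.1.1;
                   complex.Re x.1.2; complex.Im x.1.2; x.2]`_k.

(** Tangent vectors of CP^3 at [v] are represented by vectors u of C^4, taken
    modulo [v]: u stands for the velocity at t = 0 of t |-> [v + t u].  Such a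
    vector is tangent to the fiber of the twistor fibration when it is in the
    kernel of the differential of the fibration. *)
Definition vertical (R : realType) (v u : 'cV[R[i]]_4) : Prop :=
  is_derive (0 : R) (1 : R)
    (fun t : R => toR5 (twistor (proj_pt (v + (t%:C)%C *: u)))) 0.

Definition hdot (R : realType) (u w : 'cV[R[i]]_4) : R[i] := (w^t* *m u) 0 0.

(** The Fubini-Study metric at [v]: the hermitian product, rescaled by |v|^-2,
    of the components of u and w orthogonal to v. *)
Definition fubini_study (R : realType) (v u w : 'cV[R[i]]_4) : R :=
  complex.Re ((hdot u w * hdot v v - hdot u v * hdot v w) / hdot v v ^+ 2).

(** For [f1, f2, f3, f4] of degree d, the polynomial lift of the curve in the
    coordinate w = 1/z around infinity, i.e. w^d f(1/w). *)
Definition lift_infty (R : realType) (d : nat) (f : 'cV[{poly R[i]}]_4) :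
    'cV[{poly R[i]}]_4 :=
  map_mx (fun q : {poly R[i]} => \poly_(k < d.+1) q`_(d - k)) f.

Definition lift_at (R : realType) (d : nat) (f : 'cV[{poly R[i]}]_4)
    (p : S2 R) : 'cV[R[i]]_4 :=
  match p with
  | Some z => map_mx (fun q => q.[z]) f
  | None => map_mx (fun q => q.[0]) (lift_infty d f)
  end.

Definition dlift_at (R : realType) (d : nat) (f : 'cV[{poly R[i]}]_4)
    (p : S2 R) : 'cV[R[i]]_4 :=
  match p with
  | Some z => map_mx (fun q => q^`().[z]) f
  | None => map_mx (fun q => q^`().[0]) (lift_infty d f)
  end.

Definition curve (R : realType) (d : nat) (f : 'cV[{poly R[i]}]_4)
    (p : S2 R) : CP3 R := proj_pt (lift_at d f p).

(** The holomorphic curves of degree d are the maps [f1, f2, f3, f4] with f_i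
    polynomials without common zeros and of maximal degree d. *)
Definition hol_lift (R : realType) (d : nat) (f : 'cV[{poly R[i]}]_4)
    (psi : S2 R -> CP3 R) : Prop :=
  [/\ forall z : R[i], exists k : 'I_4, ~~ root (f k 0) z,
      (\max_(k < 4) size (f k 0%R))%N = d.+1
    & psi =1 curve d f].

(** The vectors xi f', for xi complex, represent the tangent vectors of the
    curve; they must be orthogonal to the fibers, including at infinity. *)
Definition horizontal_lift (R : realType) (d : nat)
    (f : 'cV[{poly R[i]}]_4) : Prop :=
  forall (p : S2 R) (xi : R[i]) (u : 'cV[R[i]]_4),
    vertical (lift_at d f p) u ->
    fubini_study (lift_at d f p) (xi *: dlift_at d f p) u = 0.

Definition linearly_full (R : realType) (psi : S2 R -> CP3 R) : Prop :=
  forall H : {vspace 'cV[R[i]]_4}, \dim H = 3%N ->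
    ~ (forall p, (psi p <= H)%VS).

Definition HHolLF (R : realType) (d : nat) (psi : S2 R -> CP3 R) : Prop :=
  (exists f, hol_lift d f psi /\ horizontal_lift d f) /\ linearly_full psi.

Definition AHHolLF (R : realType) (d : nat) (psi : S2 R -> CP3 R) : Prop :=
  HHolLF d psi /\
  forall p, twistor (psi (antipodal p)) = twistor (psi p).

Definition Psi3_lift (R : realType) : 'cV[{poly R[i]}]_4 :=
  \col_(k < 4) [:: 1; - 'X^3; ((Num.sqrt 3)%:C)%C *: 'X;
                   ((Num.sqrt 3)%:C)%C *: 'X^2]`_k.

Definition Psi3 (R : realType) : S2 R -> CP3 R := curve 3 (Psi3_lift R).

Lemma twistor_vecZ (R : realType) (c : R[i]) (v : 'cV[R[i]]_4) :
  c != 0 -> twistor_vec (c *: v) = twistor_vec v.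
Proof.
move=> c0; rewrite /twistor_vec !mxE !normrM !exprMn -!mulrDr -!mulrBr.
have n0 : `|c| ^+ 2 != 0 by rewrite expf_neq0 // normr_eq0.
have e : `|c| ^+ 2 = c * c^* by rewrite normCK.
have simp x y : `|c| ^+ 2 * x / (`|c| ^+ 2 * y) = x / y.
  by rewrite -mulf_div divff // mul1r.
rewrite !rmorphM simp.
congr (_, _, _); rewrite -[RHS]simp; congr (_ / _); rewrite e /=; ring.
Qed.

Lemma twistorE (R : realType) (v : 'cV[R[i]]_4) :
  v != 0 -> twistor (proj_pt v) = twistor_vec v.
Proof.
move=> v0; rewrite /twistor /proj_pt.
have /vlineP[c e] := memv_pick <[v]>%VS.
rewrite e twistor_vecZ //; apply: contraNneq v0 => c0.
by move/eqP: e; rewrite c0 scale0r vpick0 -dimv_eq0 dim_vline; case: (v == 0).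
Qed.

(* Main.v *)
Require Import Defs.
From mathcomp Require Import all_boot all_order all_algebra.
From mathcomp Require Import complex ring reals boolp topology normedtype derive.

(** Write e(z) = (1, z, z^2, z^3).  A cubic curve is f = A e for a 4 x 4 matrix A
    of coefficients, and every hypothesis of the theorem becomes a condition on A.

    Linear fullness says that A is invertible ([full_coef_unit]): a linear form
    killing the columns of A would put the curve in a hyperplane.

    The fibers of the twistor fibration are the quaternionic lines spanned by v
    and j v = J conj(v) ([twistor_quat_line], [twistor_fiber]).  Hence j v is a
    vertical direction at v, and a horizontal curve satisfies f^T J f' = 0.
    Comparing the coefficients of this polynomial in z shows that A^T J A is
    determined up to a scalar ([gram_of_horizontal]); as Psi3 is horizontal too,
    A^T J A is a multiple of the same matrix for Psi3.  So, after rescaling, f and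
    Psi3 differ by a complex symplectic matrix B.

    The antipodal condition says that j f(-1 / conj z), a multiple of the cubic
    polynomial G(z) = J conj(A) S e(z) for a constant matrix S, lies in the span
    of f(z) and j f(z).  This is a polynomial identity in z and conj z, so conj z
    can be replaced by an independent variable; j f then ranges over a basis of
    C^4, and the identity forces G(z) to be a multiple of f(z) for every z
    ([scalar_of_veronese]).  Comparing degrees, G = c f ([antipodal_coef]).

    The same relation holds for Psi3, so B commutes with j up to a scalar.  For a
    symplectic matrix this means that B^* B is scalar, and positivity together
    with det B = 1 makes B unitary ([symplectic_unitary]).  Thus B is in Sp(2) and
    carries psi to Psi3, with omega the identity. *)

Set Implicit Arguments.
Unset Strict Implicit.
Unset Printing Implicit Defensive.

Import Order.TTheory GRing.Theory Num.Theory.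
Import numFieldNormedType.Exports.

Local Open Scope ring_scope.
Local Open Scope sesquilinear_scope.

(** * Coordinates in dimension four *)

Lemma ord4P (P : 'I_4 -> Prop) : P 0 -> P 1 -> P 2 -> P 3 -> forall i, P i.
Proof.
move=> P0 P1 P2 P3 [[|[|[|[|//]]]] h]; [move: P0|move: P1|move: P2|move: P3];
  by congr P; apply: val_inj.
Qed.

Lemma sum4E (V : nmodType) (F : 'I_4 -> V) :
  \sum_(i < 4) F i = F 0 + F 1 + F 2 + F 3.
Proof.
rewrite !big_ord_recl big_ord0 addr0 !addrA.
by congr (F _ + F _ + F _ + F _); apply: val_inj.
Qed.

(** Laplace expansion along the first two rows: the form in which the determinant
    is compared with a Pfaffian in [det_symplectic]. *)
Lemma det4E (F : comPzRingType) (A : 'M[F]_4) : \det A =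
  (A 0 0 * A 1 1 - A 0 1 * A 1 0) * (A 2 2 * A 3 3 - A 2 3 * A 3 2)
  - (A 0 0 * A 1 2 - A 0 2 * A 1 0) * (A 2 1 * A 3 3 - A 2 3 * A 3 1)
  + (A 0 0 * A 1 3 - A 0 3 * A 1 0) * (A 2 1 * A 3 2 - A 2 2 * A 3 1)
  + (A 0 1 * A 1 2 - A 0 2 * A 1 1) * (A 2 0 * A 3 3 - A 2 3 * A 3 0)
  - (A 0 1 * A 1 3 - A 0 3 * A 1 1) * (A 2 0 * A 3 2 - A 2 2 * A 3 0)
  + (A 0 2 * A 1 3 - A 0 3 * A 1 2) * (A 2 0 * A 3 1 - A 2 1 * A 3 0).
Proof.
pose m (i j : nat) := A (inord i) (inord j).
have mE i j : A i j = m i j by rewrite /m !inord_val.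
rewrite !mE; do 4 rewrite !(expand_det_row _ ord0) !big_ord_recl !big_ord0 /cofactor.
rewrite !det_mx00 !mxE !mE /= /bump /=.
rewrite ?(expr0, exprS).
ring.
Qed.

(** * Polynomial identities in z and its conjugate *)

Lemma poly_eq0_nat (F : numDomainType) (p : {poly F}) :
  (forall n : nat, p.[n%:R] = 0) -> p = 0.
Proof.
move=> p0; apply/eqP/negPn/negP => pn0.
have := max_poly_roots pn0 (rs := [seq n%:R | n <- iota 0 (size p)]).
rewrite size_map size_iota ltnn => h; suff: false by [].
apply: h; first by apply/allP => _ /mapP[n _ ->]; apply/eqP/p0.
by rewrite map_inj_uniq ?iota_uniq // => i j /eqP; rewrite eqr_nat => /eqP.
Qed.

(** z and its conjugate are algebraically independent functions.  With z = x + i y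
    the sum is a polynomial in x and in y; vanishing for all natural x and y, it
    vanishes for all complex x and y, and then x + i y and x - i y are independent
    complex variables. *)
Lemma poly_conj_indep (C : numClosedFieldType) n (a : 'I_n -> {poly C}) :
  (forall z, \sum_j (a j).[z] * z^* ^+ j = 0) -> forall j, a j = 0.
Proof.
move=> h.
have h1 (y : nat) (x : C) :
    \sum_j (a j).[x + 'i * y%:R] * (x - 'i * y%:R) ^+ j = 0.
  pose p := \sum_j (a j \Po ('X + ('i * y%:R)%:P)) * ('X - ('i * y%:R)%:P) ^+ j.
  have pE t : p.[t] = \sum_j (a j).[t + 'i * y%:R] * (t - 'i * y%:R) ^+ j.
    rewrite horner_sum; apply: eq_bigr => j _.
    by rewrite hornerM horner_comp horner_exp !hornerE.
  rewrite -pE (_ : p = 0) ?horner0 //; apply: poly_eq0_nat => k; rewrite pE.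
  rewrite -[RHS](h (k%:R + 'i * y%:R)); apply: eq_bigr => j _; congr (_ * _ ^+ _).
  by rewrite rmorphD rmorphM /= conjCi !conj_Creal ?realn // mulNr.
have h2 (y x : C) : \sum_j (a j).[x + 'i * y] * (x - 'i * y) ^+ j = 0.
  pose p := \sum_j (a j \Po (x%:P + 'i *: 'X)) * (x%:P - 'i *: 'X) ^+ j.
  have pE t : p.[t] = \sum_j (a j).[x + 'i * t] * (x - 'i * t) ^+ j.
    rewrite horner_sum; apply: eq_bigr => j _.
    by rewrite hornerM horner_comp horner_exp !hornerE.
  by rewrite -pE (_ : p = 0) ?horner0 //; apply: poly_eq0_nat => k; rewrite pE.
have h3 (z w : C) : \sum_j (a j).[z] * w ^+ j = 0.
  rewrite -[RHS](h2 ((z - w) / (2 * 'i)) ((z + w) / 2)).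
  have i0 : 'i != 0 :> C by rewrite neq0Ci.
  by apply: eq_bigr => j _; congr (_.[_] * _ ^+ _); field; rewrite i0.
move=> j; apply: poly_eq0_nat => k.
have p0 : \sum_j0 (a j0).[k%:R] *: 'X^j0 = 0 :> {poly C}.
  apply: poly_eq0_nat => l; rewrite horner_sum -[RHS](h3 k%:R l%:R).
  by apply: eq_bigr => i _; rewrite !hornerE.
have := congr1 (fun q : {poly C} => q`_j) p0; rewrite coef0 coef_sum (bigD1 j) //=.
rewrite big1 => [|i ij]; first by rewrite addr0 coefZ coefXn eqxx mulr1.
by rewrite coefZ coefXn (inj_eq val_inj) eq_sym (negbTE ij) mulr0.
Qed.

(** With e(z) the column of powers of z, eliminate a and b from
    U e = a e + b T conj(e): the 2 x 2 minors of the vectors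
    (x_k - z^k x_0), for x = U e and x = T conj(e), vanish.  By [poly_conj_indep]
    conj(e) can be replaced by any vector, hence T conj(e) by any basis vector as
    T is invertible; so U e(z) is a multiple of e(z) for every z, by a factor
    which has degree 0 because both sides are cubic. *)
Lemma scalar_of_veronese (K : numClosedFieldType) (T U : 'M[K]_4) :
  T \in unitmx ->
  (forall z : K, exists a b, U *m (\col_k z ^+ k)
     = a *: (\col_k z ^+ k) + b *: (T *m \col_k z^* ^+ k)) ->
  exists c, U = c%:M.
Proof.
move=> uT h.
pose r (k : 'I_4) := \poly_(j < 4) U k (inord j).
have rE k z : (r k).[z] = (U *m \col_j z ^+ j) k 0.
  by rewrite horner_poly mxE; apply: eq_bigr => j _; rewrite mxE inord_val.
pose q k := r k - 'X^k * r 0.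
(* The 2 x 2 minor of indices k, m is the sum of the A k m j conj(z)^j. *)
pose A (k m j : 'I_4) := q k * ((T m j)%:P - (T 0 j) *: 'X^m)
  - q m * ((T k j)%:P - (T 0 j) *: 'X^k).
have A0 k m j : A k m j = 0.
  apply: (poly_conj_indep (a := A k m)) => z.
  have [a [b e]] := h z.
  pose y := T *m \col_k z^* ^+ k.
  have qE i : (q i).[z] = b * (y i 0 - z ^+ i * y 0 0).
    rewrite hornerD hornerN hornerM hornerXn !rE e -/y !mxE expr0; ring.
  have -> : \sum_j (A k m j).[z] * z^* ^+ j =
      (q k).[z] * (y m 0 - z ^+ m * y 0 0) - (q m).[z] * (y k 0 - z ^+ k * y 0 0).
    have yE i : y i 0 - z ^+ i * y 0 0 = \sum_j (T i j - z ^+ i * T 0 j) * z^* ^+ j.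
      rewrite /y !mxE mulr_sumr -sumrB; apply: eq_bigr => l _; rewrite !mxE; ring.
    rewrite !yE !mulr_sumr -sumrB; apply: eq_bigr => l _.
    rewrite /A !(hornerD, hornerN, hornerM, hornerC, hornerZ, hornerXn); ring.
  rewrite !qE; ring.
(* Combining the A k m j along a column of T^-1 replaces T conj(e) by the m-th
   basis vector, and the minor becomes q k. *)
have q0 k m : m != 0 -> k != m -> q k = 0.
  move=> m0 km.
  have TE i : \sum_j T i j * (invmx T) j m = (i == m)%:R.
    by have := congr1 (fun M : 'M_4 => M i m) (mulmxV uT); rewrite !mxE.
  have TP i : \sum_j ((T i j)%:P - (T 0 j) *: 'X^i) * (invmx T j m)%:P = ((i == m)%:R)%:P.
    rewrite -TE rmorph_sum /=.
    transitivity (\sum_j (T i j * invmx T j m)%:P - (\sum_j T 0 j * invmx T j m) *: 'X^i).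
      rewrite scaler_suml -sumrB; apply: eq_bigr => j _.
      by rewrite -!mul_polyC !polyCM; ring.
    by rewrite TE eq_sym (negbTE m0) scale0r subr0.
  have : \sum_j A k m j * (invmx T j m)%:P = q k * ((m == m)%:R)%:P - q m * ((k == m)%:R)%:P.
    rewrite -!TP !mulr_sumr -sumrB; apply: eq_bigr => j _; rewrite /A; ring.
  rewrite eqxx (negbTE km) mulr1 mulr0 subr0 => <-.
  by rewrite big1 // => j _; rewrite A0 mul0r.
have rX k : r k = 'X^k * r 0.
  apply/eqP; rewrite -subr_eq0 -/(q k); apply/eqP.
  have [->|k1] := eqVneq k 1; first exact: (q0 _ 2).
  exact: (q0 _ 1).
(* The product 'X^3 * r 0 = r 3 has degree at most 3. *)
have r0 : r 0 = (U 0 0)%:P.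
  apply/polyP => -[|j].
    by rewrite coefC coef_poly /=; congr (U _ _); apply: val_inj; rewrite /= inordK.
  have := congr1 (fun p : {poly K} => p`_(j.+4)) (rX 3).
  rewrite coefXnM (_ : (3 : 'I_4) = 3%N :> nat) // ltnNge /= !subSS subn0.
  by rewrite [in LHS]coef_poly coefC => <-.
exists (U 0 0); apply/matrixP => k j; rewrite mxE.
have := congr1 (fun p : {poly K} => p`_j) (rX k).
by rewrite r0 coefMC coefXn coef_poly ltn_ord inord_val mulr_natl eq_sym => ->.
Qed.

(** * Matrix algebra *)

Lemma mulmx_invl_comb (K : fieldType) n (A B F : 'M[K]_n) (x y : 'cV_n) k a b :
  A \in unitmx -> k != 0 ->
  B *m (k *: (F *m x)) = a *: (A *m x) + b *: (B *m y) ->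
  invmx A *m (B *m F) *m x = (k^-1 * a) *: x + (k^-1 * b) *: (invmx A *m B *m y).
Proof.
move=> uA k0 e; apply: (scalerI k0); rewrite scalerDr !scalerA !mulVKf //.
by move/(congr1 (mulmx (invmx A))): e; rewrite mulmxDr -!scalemxAr mulKmx // !mulmxA.
Qed.

Lemma congruence_scale (K : comNzRingType) n (mu : K) (M J : 'M[K]_n) :
  (mu *: M)^T *m J *m (mu *: M) = mu ^+ 2 *: (M^T *m J *m M).
Proof. by rewrite -scalemxAr [(mu *: M)^T]linearZ -!scalemxAl scalerA. Qed.

Lemma congruence_quotient (K : comUnitRingType) n (A B J : 'M[K]_n) :
  A \in unitmx -> (B *m A)^T *m J *m (B *m A) = A^T *m J *m A ->
  B^T *m J *m B = J.
Proof.
move=> uA; rewrite trmx_mul !mulmxA => /(can_inj (mulmxK uA)).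
by rewrite -!mulmxA => /(can_inj (mulKmx _)); apply; rewrite unitmx_tr.
Qed.

Lemma mulmx_skew_involutions (K : comNzRingType) n (J F X : 'M[K]_n) :
  J *m J = - 1%:M -> F *m F = - 1%:M -> X = J *m (J *m X *m F) *m F.
Proof.
move=> JJ FF; rewrite !mulmxA JJ -mulmxA FF !mulNmx mul1mx mulmxN mulmx1.
by rewrite opprK.
Qed.

(** If two matrices A and M both intertwine the antipodal map with the quaternionic
    structure J conj, then so does B = mu M A^-1, up to a scalar.  Here A', M',
    B', mu' stand for the complex conjugates. *)
Lemma quaternionic_quotient (K : fieldType) n (J F A M B A' M' B' : 'M[K]_n) mu mu' c :
  J *m J = - 1%:M -> A' \in unitmx -> c != 0 -> mu != 0 ->
  B *m A = mu *: M -> B' *m A' = mu' *: M' ->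
  A' = c *: (J *m A *m F) -> M' = - (J *m M *m F) ->
  B' = (mu' / (c * mu)) *: (J *m B *m J).
Proof.
move=> JJ uA' c0 mu0 BA BA' eA eM; apply: (can_inj (mulmxK uA')).
have -> : (mu' / (c * mu)) *: (J *m B *m J) *m A'
    = (mu' / mu) *: (J *m B *m (J *m J) *m A *m F).
  rewrite eA -scalemxAr -!scalemxAl scalerA !mulmxA; congr (_ *: _).
  by field; rewrite mu0 c0.
rewrite JJ mulmxN mulmx1 !mulNmx -[J *m B *m A]mulmxA BA BA' eM.
by rewrite -scalemxAr -scalemxAl !scalerN scalerA divfK.
Qed.

Section CubicCurves.
Variable R : realType.
Local Notation C := R[i].
Implicit Types (u v w : 'cV[C]_4) (a b : C).
Implicit Types (f : 'cV[{poly C}]_4) (p : S2 R) (z : C) (A : 'M[C]_4).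

(** * The quaternionic structure and the symplectic form *)

Lemma J4E (v : 'cV[R[i]]_4) : J4 R *m v =
  \col_(k < 4) [:: - v 1 0; v 0 0; - v 3 0; v 2 0]`_k.
Proof.
apply/colP => i; rewrite !mxE.
have s0 : split (0 : 'I_(2 + 2)) = inl 0.
  by case: splitP => // j e; congr inl; apply: val_inj.
have s1 : split (1 : 'I_(2 + 2)) = inl 1.
  by case: splitP => // j e; congr inl; apply: val_inj.
have s2 : split (2 : 'I_(2 + 2)) = inr 0.
  by case: splitP => [[[|[|//]] ?]|[[|[|//]] ?] e] //; congr inr; apply: val_inj.
have s3 : split (3 : 'I_(2 + 2)) = inr 1.
  by case: splitP => [[[|[|//]] ?]|[[|[|//]] ?] e] //; congr inr; apply: val_inj.
rewrite /J4 sum4E.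
elim/ord4P: i; rewrite !mxE /= ?(s0, s1, s2, s3) !mxE ?(s0, s1, s2, s3) !mxE /=; ring.
Qed.

Lemma J4_entry i j : J4 R i j =
  [:: - (j == 1)%:R; (j == 0)%:R; - (j == 3)%:R; (j == 2)%:R]`_i.
Proof.
have -> : J4 R i j = (J4 R *m delta_mx j (0 : 'I_1)) i 0 by rewrite -colE [RHS]mxE.
by rewrite J4E !mxE !eqxx !andbT ![_ == j]eq_sym.
Qed.

Lemma J4_tr : (J4 R)^T = - J4 R.
Proof.
by apply/matrixP => i j; move: (J4 R) J4_entry => J JE; rewrite !mxE !JE; elim/ord4P: i;
  elim/ord4P: j; rewrite /= ?mulr1n ?mulr0n ?oppr0 ?opprK.
Qed.

Lemma J4_sqr : J4 R *m J4 R = - 1%:M.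
Proof.
apply/matrixP => i j; move: (J4 R) J4_entry => J JE; rewrite !mxE sum4E !JE.
by elim/ord4P: i; elim/ord4P: j; rewrite /=; ring.
Qed.

Lemma J4_conj : map_mx Num.conj (J4 R) = J4 R.
Proof.
by apply/matrixP => i j; move: (J4 R) J4_entry => J JE; rewrite !mxE !JE; elim/ord4P: i;
  elim/ord4P: j; rewrite /= ?rmorphN /= ?rmorph0 ?rmorph1.
Qed.

Lemma J4_unit : J4 R \in unitmx.
Proof.
by apply: (mulmx1_unit (B := - J4 R) _).1; rewrite mulmxN J4_sqr opprK.
Qed.

(** The Pfaffian of A^T J A is det A times the Pfaffian of J; the equation for
    A alone gives only (det A)^2 = 1. *)
Lemma det_symplectic A : A^T *m J4 R *m A = J4 R -> \det A = 1.
Proof.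
move=> h.
pose w i j := - A 0 i * A 1 j + A 1 i * A 0 j - A 2 i * A 3 j + A 3 i * A 2 j.
have hE i j : w i j = J4 R i j.
  rewrite -h mxE sum4E ![(_ *m J4 R) _ _]mxE !sum4E ![(A^T) _ _]mxE !J4_entry /w /=.
  ring.
have -> : \det A = w 0 1 * w 2 3 - w 0 2 * w 1 3 + w 0 3 * w 1 2.
  rewrite det4E /w; ring.
rewrite !hE !J4_entry /=; ring.
Qed.

(** Multiplication by the quaternion j on C^4 = H^2. *)
Definition quat_j v : 'cV[R[i]]_4 := J4 R *m map_mx Num.conj v.

Lemma quat_jE v : quat_j v =
  \col_(k < 4) [:: - (v 1 0)^*; (v 0 0)^*; - (v 3 0)^*; (v 2 0)^*]`_k.
Proof. by rewrite /quat_j J4E; apply/colP; elim/ord4P; rewrite !mxE. Qed.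

Lemma hdotE u w : hdot u w = (w 0 0)^* * u 0 0 + (w 1 0)^* * u 1 0
  + (w 2 0)^* * u 2 0 + (w 3 0)^* * u 3 0.
Proof. by rewrite /hdot mxE sum4E !mxE. Qed.

Lemma hdot_eq0 v : (hdot v v == 0) = (v == 0).
Proof.
apply/idP/eqP => [|->]; last by rewrite hdotE !mxE !mulr0 !addr0.
rewrite hdotE ![_^* * _]mulrC -!normCK !paddr_eq0 ?addr_ge0 ?exprn_ge0 //.
rewrite !expf_eq0 /= !normr_eq0 => /andP[/andP[/andP[/eqP e0 /eqP e1] /eqP e2] /eqP e3].
by apply/colP; elim/ord4P; rewrite mxE.
Qed.

Lemma hdot_quat_line a b v :
  hdot (a *: v + b *: quat_j v) (a *: v + b *: quat_j v)
    = (a * a^* + b * b^*) * hdot v v.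
Proof.
rewrite !hdotE quat_jE !mxE /= !rmorphD !rmorphM !rmorphN /= !conjCK; ring.
Qed.

Lemma hdot_quat_j v : hdot v (quat_j v) = 0.
Proof. rewrite hdotE quat_jE !mxE /= !rmorphN /= !conjCK; ring. Qed.

Lemma conj_sum_neq0 a b : (a != 0) || (b != 0) -> a * a^* + b * b^* != 0.
Proof.
by rewrite -!normCK paddr_eq0 ?exprn_ge0 // !expf_eq0 /= !normr_eq0 negb_and.
Qed.

Lemma quat_line_neq0 a b v : v != 0 -> (a != 0) || (b != 0) ->
  a *: v + b *: quat_j v != 0.
Proof.
move=> v0 ab0; rewrite -hdot_eq0 hdot_quat_line mulf_neq0 ?hdot_eq0 //.
exact: conj_sum_neq0.
Qed.

(** * Fibers of the twistor fibration *)

(** Numerators and denominator of the twistor map are all multiplied by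
    |a|^2 + |b|^2. *)
Lemma twistor_quat_line a b v : (a != 0) || (b != 0) ->
  twistor_vec (a *: v + b *: quat_j v) = twistor_vec v.
Proof.
move=> /conj_sum_neq0; set k := _ + _ => k0; rewrite /twistor_vec !normCK.
rewrite quat_jE !mxE /= !rmorphD !rmorphM !rmorphN /= !conjCK.
have simp x y : k * x / (k * y) = x / y by rewrite -mulf_div divff // mul1r.
by congr (_, _, complex.Re _); rewrite -[RHS]simp /k; congr (_ / _); ring.
Qed.

Lemma twistor_quat_j v : twistor_vec (quat_j v) = twistor_vec v.
Proof.
rewrite -[RHS](twistor_quat_line (a := 0) (b := 1)) ?oner_eq0 ?orbT //.
by rewrite scale0r add0r scale1r.
Qed.

Lemma Re_real_inj a b : a \is Num.real -> b \is Num.real ->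
  complex.Re a = complex.Re b -> a = b.
Proof. by move=> /RRe_real ea /RRe_real eb e; rewrite -ea -eb e. Qed.

(** The orthogonal projection on the span of v and j v has a matrix whose entries
    are affine functions of the coordinates of the twistor map and of their
    conjugates, so it is the same for v and w; it fixes w,
    and it is x |-> (<x, v> v + <x, j v> j v) / |v|^2. *)
Lemma twistor_fiber v w : v != 0 -> w != 0 -> twistor_vec w = twistor_vec v ->
  exists a b, w = a *: v + b *: quat_j v.
Proof.
rewrite -!hdot_eq0 => n0 m0 [E1 E2 E3].
exists (hdot w v / hdot v v), (hdot w (quat_j v) / hdot v v).
have tr u : (`|u 0 0| ^+ 2 + `|u 1 0| ^+ 2 - `|u 2 0| ^+ 2 - `|u 3 0| ^+ 2)
    / (`|u 0 0| ^+ 2 + `|u 1 0| ^+ 2 + `|u 2 0| ^+ 2 + `|u 3 0| ^+ 2) \is Num.real.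
  by rewrite !(realD, realN, rpredM, rpredV, rpredX, rpredD, rpredB) ?normr_real.
move: (Re_real_inj (tr _) (tr _) E3) E1 E2 => {E3 tr}.
have nE u : `|u 0 0| ^+ 2 + `|u 1 0| ^+ 2 + `|u 2 0| ^+ 2 + `|u 3 0| ^+ 2 = hdot u u.
  by rewrite hdotE !normCK; ring.
rewrite !nE !normCK.
have c2 : 2 != 0 :> R[i] by rewrite pnatr_eq0.
have nC u : (hdot u u)^* = hdot u u.
  by rewrite hdotE !rmorphD !rmorphM /= !conjCK; ring.
have cross x y z t : y != 0 -> t != 0 -> x / y = z / t -> x * t = z * y :> R[i].
  by move=> y0 t0 /eqP; rewrite eqr_div // => /eqP.
move=> /(cross _ _ _ _ m0 n0) E3 /(cross _ _ _ _ m0 n0) E1 /(cross _ _ _ _ m0 n0) E2.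
move: E1 E2; rewrite -!mulrA => /(mulfI c2) E1 /(mulfI c2) E2.
move: (congr1 Num.conj E1) (congr1 Num.conj E2).
rewrite !(rmorphM, rmorphD, rmorphN) /= !nC !conjCK => E1' E2'.
have fin i : 2 * hdot w w * (hdot v v * w i 0
    - (hdot w v * v i 0 + hdot w (quat_j v) * quat_j v i 0)) = 0 ->
    w i 0 = (hdot w v / hdot v v) * v i 0 + (hdot w (quat_j v) / hdot v v) * quat_j v i 0.
  move/eqP; rewrite mulf_eq0 (negbTE (mulf_neq0 c2 m0)) /= subr_eq0 => /eqP e.
  by apply: (mulfI n0); rewrite e; field.
apply/colP => i; rewrite mxE [X in _ = X + _]mxE [X in _ = _ + X]mxE.
apply: fin; rewrite quat_jE.
have comb (c3 c1 c2' : R[i]) x3 x1 x2 y3 y1 y2 t : x3 = y3 -> x1 = y1 -> x2 = y2 ->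
    t = c3 * (x3 - y3) + c1 * (x1 - y1) + c2' * (x2 - y2) -> t = 0.
  by move=> -> -> -> ->; rewrite !subrr !mulr0 !addr0.
(* Write the twistor map as (2 X, 2 Y, T) / |v|^2.  Twice |v|^2 times a coordinate
   w_i of the projection of w is |v|^2 w_i plus a combination of T, X and Y, where
   X and Y may be conjugated; its coefficients are the factors used below. *)
elim/ord4P: i.
- apply: (comb (w 0 0) (2 * w 2 0) (2 * w 3 0) _ _ _ _ _ _ _ E3 E1' E2').
  by rewrite !hdotE !mxE /= !rmorphN /= !conjCK; ring.
- apply: (comb (w 1 0) (2 * w 3 0) (- 2 * w 2 0) _ _ _ _ _ _ _ E3 E1 E2).
  by rewrite !hdotE !mxE /= !rmorphN /= !conjCK; ring.
- apply: (comb (- w 2 0) (2 * w 0 0) (- 2 * w 1 0) _ _ _ _ _ _ _ E3 E1 E2').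
  by rewrite !hdotE !mxE /= !rmorphN /= !conjCK; ring.
- apply: (comb (- w 3 0) (2 * w 1 0) (2 * w 0 0) _ _ _ _ _ _ _ E3 E1' E2).
  by rewrite !hdotE !mxE /= !rmorphN /= !conjCK; ring.
Qed.

Lemma vertical_quat_j v : v != 0 -> vertical v (quat_j v).
Proof.
move=> v0; rewrite /vertical.
rewrite (_ : (fun t => _) = functions.cst (toR5 (twistor_vec v))); last first.
  apply/funext => t; rewrite -[v in v + _]scale1r /= twistorE.
    by rewrite twistor_quat_line ?oner_eq0.
  by rewrite quat_line_neq0 ?oner_eq0.
exact: is_derive_cst.
Qed.

(** Orthogonality to the vertical vector j v is the vanishing of the symplectic
    product with v, because <u, j v> = - v^T J u.  The metric is the real part of
    a hermitian product; taking for xi the conjugate of <u, j v> turns that real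
    part into |<u, j v>|^2 / |v|^2. *)
Lemma horizontal_symplectic v (u : 'cV[R[i]]_4) : v != 0 ->
  (forall (xi : R[i]) u0, vertical v u0 -> fubini_study v (xi *: u) u0 = 0) ->
  (v^T *m J4 R *m u) 0 0 = 0.
Proof.
move=> v0 hor.
have -> : (v^T *m J4 R *m u) 0 0 = - hdot u (quat_j v).
  have e : (quat_j v)^t* = - (v^T *m J4 R).
    rewrite /quat_j trmx_mul J4_tr mulmxN map_mxN map_mxM J4_conj.
    by congr (- (_ *m _)); apply/matrixP => i j; rewrite !mxE /= conjCK.
  by rewrite /hdot e mulNmx [X in _ = - X]mxE opprK.
have n0 : hdot v v != 0 by rewrite hdot_eq0.
set h := hdot u _.
have := hor h^* _ (vertical_quat_j v0); rewrite /fubini_study hdot_quat_j mulr0 subr0.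
have -> : hdot (h^* *: u) (quat_j v) = `|h| ^+ 2.
  by rewrite normCKC /h /hdot -scalemxAr mxE.
rewrite expr2 -mulf_div divff // mulr1 => e.
have nn : 0 <= hdot v v.
  by rewrite hdotE !addr_ge0 // mulrC -normCK exprn_ge0.
have : `|h| ^+ 2 / hdot v v = 0.
  apply: Re_real_inj; rewrite ?e ?rpred0 ?ger0_real //.
  by rewrite divr_ge0 ?exprn_ge0.
move/eqP; rewrite mulf_eq0 invr_eq0 (negbTE n0) orbF expf_eq0 normr_eq0 => /eqP->.
by rewrite oppr0.
Qed.

(** * Cubic curves as matrices *)

Definition veronese (p : S2 R) : 'cV[C]_4 :=
  \col_k if p is Some z then z ^+ k else (k == 3)%:R.

Definition coef_mx (f : 'cV[{poly C}]_4) : 'M[C]_4 := \matrix_(i, k) (f i 0)`_k.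

Lemma veronese_neq0 p : veronese p != 0.
Proof.
apply/negP => /eqP/colP h; case: p h => [z|] h.
  by have /eqP := h 0; rewrite !mxE expr0 oner_eq0.
by have /eqP := h 3; rewrite !mxE /= oner_eq0.
Qed.

Lemma curve_neq0 A p : A \in unitmx -> A *m veronese p != 0.
Proof.
move=> uA; apply/negP => /eqP e; have /negP[] := veronese_neq0 p.
by rewrite -[veronese p](mulKmx uA) e mulmx0.
Qed.

Lemma lift_at_coef f p : (forall k, (size (f k 0%R) <= 4)%N) ->
  lift_at 3 f p = coef_mx f *m veronese p.
Proof.
move=> sf; apply/colP => i; case: p => [z|]; rewrite !mxE.
  by rewrite (horner_coef_wide _ (sf i)); apply: eq_bigr => j _; rewrite !mxE.
rewrite horner_coef0 coef_poly /= (bigD1 3) //= !mxE eqxx mulr1 big1 ?addr0 //.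
by move=> j /negbTE j3; rewrite !mxE j3 mulr0.
Qed.

Lemma dlift_at_coef f z : (forall k, (size (f k 0%R) <= 4)%N) ->
  dlift_at 3 f (Some z) = coef_mx f *m \col_k (z ^+ k.-1 *+ k).
Proof.
move=> sf; apply/colP => i; rewrite !mxE.
have s3 : (size (f i 0%R)^`() <= 3)%N.
  by apply: leq_trans (size_poly _ _) _; have := sf i; case: size.
rewrite (horner_coef_wide _ s3) sum4E !big_ord_recl big_ord0 !mxE !coef_deriv /=.
rewrite /bump /= !modn_small //; ring.
Qed.

Lemma full_coef_unit f : linearly_full (fun p => proj_pt (coef_mx f *m veronese p)) ->
  coef_mx f \in unitmx.
Proof.
rewrite unitmxE unitfE => h; apply/negP => /det0P[u u0 uf].
pose l := linfun (mulmx u : 'cV[C]_4 -> 'cV[C]_1); pose H := lker l.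
have uE v : (v \in H) = (u *m v == 0) by rewrite memv_ker lfunE.
apply: (h H); last by move=> p; rewrite -memvE uE mulmxA uf mul0mx.
have := limg_ker_dim l fullv.
rewrite capfv dimvf dim_matrix -/H => e.
suff : (\dim (limg l) = 1)%N.
  by move=> d1; move: e; rewrite d1 addn1 => -[].
apply/eqP; rewrite eqn_leq; apply/andP; split.
  by rewrite (leq_trans (dimvS (subvf _))) // dimvf dim_matrix.
rewrite lt0n dimv_eq0; apply/negP => /eqP l0; move/negP: u0; apply.
apply/eqP/rowP => i.
have : l (delta_mx i 0) \in limg l.
  by rewrite memv_img ?memvf.
by rewrite l0 memv0 lfunE /= -colE => /eqP/matrixP/(_ 0 0); rewrite !mxE.
Qed.

Definition mx4 (s : seq (seq C)) : 'M[C]_4 := \matrix_(i, j) (nth [::] s i)`_j.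

Lemma Psi3_size k : (size (Psi3_lift R k 0%R) <= 4)%N.
Proof.
rewrite mxE; elim/ord4P: k => /=.
- by rewrite size_poly1.
- by rewrite size_polyN size_polyXn.
- by rewrite (leq_trans (size_scale_leq _ _)) // size_polyX.
- by rewrite (leq_trans (size_scale_leq _ _)) // size_polyXn.
Qed.

Local Notation psi3_mx := (coef_mx (Psi3_lift R)).

Lemma coef_mx_Psi3 : let s := ((Num.sqrt 3)%:C)%C in psi3_mx =
  mx4 [:: [:: 1; 0; 0; 0]; [:: 0; 0; 0; -1]; [:: 0; s; 0; 0]; [:: 0; 0; s; 0]].
Proof.
move=> s; apply/matrixP => i j; rewrite !mxE; elim/ord4P: i; elim/ord4P: j;
  rewrite /= ?(coefN, coef1, coefZ, coefX, coefXn) /= ?(oppr0, mulr0, mulr1) //.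
Qed.

Lemma sqrt3_sqr : ((Num.sqrt 3)%:C)%C ^+ 2 = 3 :> C.
Proof.
by rewrite -rmorphXn /= sqr_sqrtr ?ler0n // rmorph_nat.
Qed.

(** * Horizontal cubic curves *)

(** The matrix of the skew form with e(z)^T [gram3] e(w) = (w - z)^3. *)
Definition gram3 : 'M[C]_4 :=
  mx4 [:: [:: 0; 0; 0; 1]; [:: 0; 0; -3; 0]; [:: 0; 3; 0; 0]; [:: -1; 0; 0; 0]].

Lemma gram_Psi3 : psi3_mx^T *m J4 R *m psi3_mx = gram3.
Proof.
rewrite coef_mx_Psi3 /=; move: sqrt3_sqr; set s := (_%:C)%C => s2.
apply/matrixP => i j; rewrite mxE sum4E ![(_ *m J4 R) _ _]mxE !sum4E.
rewrite ![(mx4 _)^T _ _]mxE ![mx4 _ _ _]mxE !J4_entry.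
elim/ord4P: i; elim/ord4P: j; rewrite /= -?s2; ring.
Qed.

(** For skew-symmetric W the polynomial e(z)^T W e'(z) has degree 4; its five
    coefficients leave only the entry W 0 3 free. *)
Lemma gram_of_horizontal (W : 'M[C]_4) : W^T = - W ->
  (forall z, ((\col_k z ^+ k)^T *m W *m \col_k (z ^+ k.-1 *+ k)) 0 0 = 0) ->
  W = W 0 3 *: gram3.
Proof.
move=> aW h.
have W' i j : W i j = - W j i.
  by have := congr1 (fun M : 'M_4 => M j i) aW; rewrite mxE [RHS]mxE.
have c2 : 2 != 0 :> C by rewrite pnatr_eq0.
have Wii i : W i i = 0.
  apply: (mulfI c2); rewrite mulr0 mulr2n mulrDl mul1r {1}W'; exact: addNr.
pose q := Poly [:: W 0 1; 2 * W 0 2; 3 * W 0 3 + W 1 2; 2 * W 1 3; W 2 3].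
have q0 : q = 0.
  apply: poly_eq0_nat => n; rewrite horner_Poly -[RHS](h n%:R) /=.
  rewrite mxE sum4E ![(_ *m W) _ _]mxE !sum4E ![(\col__ _)^T _ _]mxE ![(\col__ _) _ _]mxE.
  rewrite (W' 1 0) (W' 2 0) (W' 3 0) (W' 2 1) (W' 3 1) (W' 3 2) !Wii /= !modn_small //.
  ring.
have e k : (nth 0 [:: W 0 1; 2 * W 0 2; 3 * W 0 3 + W 1 2; 2 * W 1 3; W 2 3] k) = 0.
  by rewrite -coef_Poly -/q q0 coef0.
have e01 : W 0 1 = 0 := e 0%N.
have e02 : W 0 2 = 0 by apply: (mulfI c2); rewrite mulr0; exact: (e 1%N).
have e12 : W 1 2 = - 3 * W 0 3.
  by apply/eqP; rewrite mulNr -addr_eq0 addrC; apply/eqP; exact: (e 2%N).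
have e13 : W 1 3 = 0 by apply: (mulfI c2); rewrite mulr0; exact: (e 3%N).
have e23 : W 2 3 = 0 := e 4%N.
apply/matrixP => i j; rewrite [RHS]mxE [gram3 _ _]mxE.
elim/ord4P: i; elim/ord4P: j => /=;
  rewrite ?(W' 1 0) ?(W' 2 0) ?(W' 3 0) ?(W' 2 1) ?(W' 3 1) ?(W' 3 2) ?Wii;
  rewrite ?e01 ?e02 ?e12 ?e13 ?e23; ring.
Qed.

(** * Antipodal cubic curves *)

(** For z != 0 the conjugate of e(-1 / conj z) is z^-3 times [flip] e(z). *)
Definition flip : 'M[C]_4 :=
  mx4 [:: [:: 0; 0; 0; 1]; [:: 0; 0; -1; 0]; [:: 0; 1; 0; 0]; [:: -1; 0; 0; 0]].

Lemma flip_sqr : flip *m flip = - 1%:M.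
Proof.
by apply/matrixP => i j; rewrite !mxE sum4E !mxE; elim/ord4P: i; elim/ord4P: j;
  rewrite /=; ring.
Qed.

Lemma quat_flip_Psi3 :
  J4 R *m map_mx Num.conj psi3_mx *m flip = - psi3_mx.
Proof.
rewrite coef_mx_Psi3 /=; set s := (_%:C)%C.
have sC : s^* = s by rewrite conj_Creal // /s complex_real.
apply/matrixP => i j; rewrite [LHS]mxE sum4E ![(J4 R *m _) _ _]mxE !sum4E.
rewrite [RHS]mxE !J4_entry ![(map_mx _ _) _ _]mxE ![mx4 _ _ _]mxE.
elim/ord4P: i; elim/ord4P: j; rewrite /= ?rmorphN /= ?sC ?rmorph1 ?rmorph0; ring.
Qed.

(** The quaternion j maps the point at the antipode of z into the span of f(z) and
    j f(z), as it moves points inside the fibers.  After multiplication by A^-1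
    this is the hypothesis of [scalar_of_veronese], with T = A^-1 J conj(A) and
    U = T [flip]. *)
Lemma antipodal_coef A : A \in unitmx ->
  (forall z, twistor_vec (A *m veronese (antipodal (Some z)))
    = twistor_vec (A *m veronese (Some z))) ->
  exists c, J4 R *m map_mx Num.conj A *m flip = c *: A.
Proof.
move=> uA h.
have uA' : map_mx Num.conj A \in unitmx by rewrite map_unitmx.
have nz p : A *m veronese p != 0 by exact: curve_neq0.
have fl z : exists2 k, k != 0 &
    map_mx Num.conj (veronese (antipodal (Some z))) = k *: (flip *m veronese (Some z)).
  rewrite /antipodal; have [->|z0] := eqVneq z 0.
    (* The antipode of 0 is infinity, where the curve is read off its top
       coefficients. *)
    exists (-1); first by rewrite oppr_eq0 oner_eq0.
    apply/colP => i; rewrite !mxE sum4E !mxE.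
    elim/ord4P: i; rewrite /= ?rmorph0 ?rmorph1 !modn_small //; ring.
  exists (z ^- 3); first by rewrite invr_eq0 expf_neq0.
  apply/colP => i; rewrite !mxE sum4E !mxE rmorphXn rmorphN fmorphV /= conjCK.
  by elim/ord4P: i; rewrite /= !modn_small //; field.
have [c e] : exists c, invmx A *m (J4 R *m map_mx Num.conj A *m flip) = c%:M.
  apply: (@scalar_of_veronese _ (invmx A *m (J4 R *m map_mx Num.conj A))).
    by rewrite !unitmx_mul unitmx_inv uA J4_unit.
  move=> z; have [k k0 ek] := fl z.
  set v := A *m veronese (Some z); set w := A *m veronese (antipodal (Some z)).
  have [|||a [b ab]] := @twistor_fiber v (quat_j w).
  - exact: nz.
  - have := @quat_line_neq0 0 1 w (nz _).
    by rewrite scale0r add0r scale1r oner_eq0 orbT => ->.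
  - by rewrite twistor_quat_j h.
  exists (k^-1 * a), (k^-1 * b).
  have eV : (\col_i z ^+ i) = veronese (Some z) by [].
  have eV' : (\col_i z^* ^+ i) = map_mx Num.conj (veronese (Some z)).
    by apply/colP => i; rewrite !mxE rmorphXn.
  rewrite eV eV'; apply: (mulmx_invl_comb uA k0).
  move: ab; rewrite /quat_j !map_mxM !mulmxA ek => ab.
  exact: ab.
by exists c; rewrite -[LHS](mulKVmx uA) e mul_mx_scalar.
Qed.

(** * The normal form *)

(** Conjugating the hypothesis on conj A into A^* = k J A^T J gives
    A^* A = k J (A^T J A) = - k.  The diagonal entries of A^* A are sums of squared
    moduli and its determinant is 1, so - k = 1. *)
Lemma symplectic_unitary A k : A^T *m J4 R *m A = J4 R ->
  map_mx Num.conj A = k *: (J4 R *m A *m J4 R) -> A \is unitarymx.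
Proof.
move=> sA cA.
have e : A^t* *m A = (- k)%:M.
  have -> : A^t* = k *: (J4 R *m A^T *m J4 R).
    by rewrite -map_trmx cA linearZ /= !trmx_mul J4_tr mulNmx !mulmxN opprK mulmxA.
  by rewrite -scalemxAl -!mulmxA [_ *m (J4 R *m A)]mulmxA sA J4_sqr scalerN scalemx1 raddfN.
have k0 : 0 <= - k.
  have : (A^t* *m A) 0 0 = - k by rewrite e mxE eqxx.
  move=> <-; rewrite mxE sumr_ge0 // => i _.
  by rewrite !mxE mulrC -normCK exprn_ge0.
have k1 : (- k) ^+ 4 = 1.
  have := congr1 determinant e.
  by rewrite det_mulmx det_scalar det_map_mx det_tr det_symplectic // rmorph1 mulr1 => <-.
have {k1 k0} k1 : - k = 1 by apply/eqP; rewrite -(pexpr_eq1 (n := 4)) ?k1.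
by apply/unitarymxP/mulmx1C; rewrite e k1.
Qed.

(** The matrix B is sqrt(a) M A^-1, where M is the matrix of Psi3: the square root
    is forced by B^T J B = J, since A^T J A = a M^T J M. *)
Lemma Sp2_normal_form A a c : A \in unitmx ->
  A^T *m J4 R *m A = a *: gram3 ->
  J4 R *m map_mx Num.conj A *m flip = c *: A ->
  exists B mu, [/\ Sp2 B, mu != 0 & B *m A = mu *: psi3_mx].
Proof.
move=> uA gA qA.
have uA' : map_mx Num.conj A \in unitmx by rewrite map_unitmx.
have unz (M : 'M[C]_4) : M \in unitmx -> M <> 0.
  by move=> uM MZ; move: uM; rewrite MZ unitmxE det0 unitr0.
have eA : map_mx Num.conj A = c *: (J4 R *m A *m flip).
  by rewrite (mulmx_skew_involutions (map_mx Num.conj A) J4_sqr flip_sqr) qA -scalemxAr -scalemxAl.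
have a0 : a != 0.
  apply/eqP => a0; apply: (unz _ J4_unit).
  have : A^T *m (J4 R *m A) = 0 by rewrite mulmxA gA a0 scale0r.
  move=> /(congr1 (mulmx (invmx A^T))); rewrite mulKmx ?unitmx_tr // mulmx0.
  by move=> /(congr1 (mulmxr (invmx A))); rewrite /= mulmxK // mul0mx.
have c0 : c != 0.
  apply/eqP => c0; apply: (unz _ uA').
  by rewrite eA c0 scale0r.
pose mu := sqrtC a; have mu2 : mu ^+ 2 = a by rewrite sqrtCK.
have mu0 : mu != 0 by rewrite /mu sqrtC_eq0.
pose B := mu *: (psi3_mx *m invmx A).
have BA : B *m A = mu *: psi3_mx by rewrite /B -scalemxAl mulmxKV.
have sB : B^T *m J4 R *m B = J4 R.
  apply: (congruence_quotient uA).
  by rewrite BA congruence_scale gram_Psi3 gA mu2.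
exists B, mu; split=> //; split; first by split; [exact: det_symplectic|].
apply: (symplectic_unitary (k := mu^* / (c * mu)) sB).
apply: (quaternionic_quotient J4_sqr uA' c0 mu0 BA (M' := map_mx Num.conj psi3_mx) _ eA).
  by rewrite -map_mxM BA map_mxZ.
rewrite {1}(mulmx_skew_involutions (map_mx Num.conj psi3_mx) J4_sqr flip_sqr) quat_flip_Psi3.
by rewrite mulmxN mulNmx.
Qed.

Lemma proj_ptZ (a : C) (v : 'cV[C]_4) : a != 0 -> proj_pt (a *: v) = proj_pt v.
Proof.
move=> a0; apply: subv_anti; rewrite /proj_pt -!memvE memvZ ?memv_line //=.
by rewrite -{1}[v](scalerK a0) memvZ ?memv_line.
Qed.

Lemma mobius1 p : mobius 1%:M p = p.
Proof.
case: p => [z|]; rewrite /mobius !mxE /= ?eqxx //.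
by rewrite mul0r add0r oner_eq0 mul1r addr0 divr1.
Qed.

End CubicCurves.

Theorem theorem6p1 (R : realType) (psi : S2 R -> CP3 R) :
  AHHolLF 3 psi ->
  exists g : CP3 R -> CP3 R, exists omega : S2 R -> S2 R,
    PSp2 g /\ PSU2 omega /\ (forall p : S2 R, g (psi (omega p)) = Psi3 p).
Proof.
move=> [[[f [[_ degf psiE] horf]] full] anti].
have sf k : (size (f k 0%R) <= 4)%N.
  by have := @leq_bigmax _ (fun k : 'I_4 => size (f k 0%R)) k; rewrite degf.
pose A := coef_mx f.
have psiA p : psi p = proj_pt (A *m veronese p).
  by rewrite psiE /curve lift_at_coef.
have uA : A \in unitmx.
  apply: full_coef_unit => H dH sub; apply: (full H dH) => p.
  by rewrite psiA.
have nz p : A *m veronese p != 0 by exact: curve_neq0.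
have gA : A^T *m J4 R *m A = (A^T *m J4 R *m A) 0 3 *: gram3 R.
  apply: gram_of_horizontal.
    by rewrite !trmx_mul J4_tr trmxK mulNmx mulmxN mulmxA.
  move=> z; have := horf (Some z).
  rewrite lift_at_coef // dlift_at_coef // => /(horizontal_symplectic (nz _)).
  by rewrite trmx_mul !mulmxA.
have [c qA] : exists c, J4 R *m map_mx Num.conj A *m flip R = c *: A.
  apply: (antipodal_coef uA) => z.
  by have := anti (Some z); rewrite !psiA !twistorE.
have [B [mu [sB mu0 BA]]] := Sp2_normal_form uA gA qA.
exists (proj_act B), id; split; [by exists B|split].
  exists 1%:M; split; [|exact: det1|by move=> p; rewrite mobius1].
  by apply/unitarymxP; rewrite mul1mx trmx1 map_mx1.
move=> p; rewrite psiA /proj_act limg_line lfunE /= mulmxA BA -scalemxAl.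
by rewrite -/(proj_pt _) proj_ptZ // /Psi3 /curve lift_at_coef //; exact: Psi3_size.
Qed.
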